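(* Let $n \ge 3$ and let $J_n$ be the cactus group. The group $J_n/\Gamma_3(J_n)$ has order $2^{\lfloor n/2\rfloor + n - 1}$, and it is generated by (the images of) $\{\sigma_i \mid i = 2,3,\dots,n\}$, where $\sigma_i := \sigma_{1,i}$, subject to the relations (i.e. these generators and relations form a presentation of it): \begin{align*} &\sigma_i^2 = 1 && \text{for } 2 \le i \le n,\\ &[\sigma_i,\sigma_j] = 1 && \text{for } 2\le i,j\le n \text{ with } i < \left\lfloor \tfrac{n+1}{2}\right\rfloor \text{ or } j \equiv i \pmod 2,\\ &[\sigma_i,\sigma_j,\sigma_k] = 1 && \text{for } 2 \le i,j,k \le n,\\ &[\sigma_i,\sigma_j] = [\sigma_i,\sigma_k] && \text{for } 2 \le i \le j,k \le n \text{ and } k \equiv j \pmod 2. \end{align*} In particular, $J_4/\Gamma_3(J_4) \cong \mathbb{Z}_2^2 \wr \mathbb{Z}_2$ and $J_5/\Gamma_3(J_5) \cong \mathbb{Z}_2 \times (\mathbb{Z}_2^2 \wr \mathbb{Z}_2)$.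
   Context: For integers $p<q$ write $[p,q]=\{p,p+1,\dots,q\}$. For $n\ge 2$ the cactus group $J_n$ is the group generated by $\{\sigma_{p,q} \mid 1\le p<q\le n\}$ with defining relations (1) $\sigma_{p,q}^2=1$ for $1\le p<q\le n$; (2) $\sigma_{p,q}\sigma_{r,s}=\sigma_{r,s}\sigma_{p,q}$ whenever $[p,q]\cap[r,s]=\emptyset$; (3) $\sigma_{p,q}\sigma_{r,s}=\sigma_{p+q-s,\,p+q-r}\,\sigma_{p,q}$ whenever $[r,s]\subset[p,q]$. For elements of a group $G$, $[g_1,g_2]=g_1^{-1}g_2^{-1}g_1g_2$ and $[g_1,g_2,g_3]=[[g_1,g_2],g_3]$. The lower central series is $\Gamma_1(G)=G$, $\Gamma_{m+1}(G)=[\Gamma_m(G),G]$ for $m\ge 1$. $\mathbb{Z}_2$ denotes the cyclic group of order $2$, and $\mathbb{Z}_2^2\wr\mathbb{Z}_2=(\mathbb{Z}_2^2\times\mathbb{Z}_2^2)\rtimes\mathbb{Z}_2$, with $\mathbb{Z}_2$ acting by exchanging the two factors. *)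

(* Defs.v *)
From HB Require Import structures.
From mathcomp Require Import all_boot all_fingroup zmodp.
From mathcomp Require Import generic_quotient boolp classical_sets cardinality.

Set Implicit Arguments.
Unset Strict Implicit.
Unset Printing Implicit Defensive.

Local Open Scope classical_set_scope.
Local Open Scope group_scope.

Section Subgroups.
Variable G : groupType.

Definition is_subgroup (H : set G) : Prop :=
  [/\ H 1, forall x y, H x -> H y -> H (x * y) & forall x, H x -> H x^-1].

Definition is_normal (N : set G) : Prop :=
  is_subgroup N /\ forall x g, N x -> N (x ^ g).

Definition gen_by (A : set G) : set G := smallest is_subgroup A.

Definition normal_closure (A : set G) : set G := smallest is_normal A.

Definition commutator_subgroup (A B : set G) : set G :=
  gen_by [set [~ a, b] | a in A & b in B].

Record normal_subgroup := NormalSubgroup {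
  normal_set :> set G;
  normal_setP : is_normal normal_set }.

Lemma normal_closureP (A : set G) : is_normal (normal_closure A).
Proof.
split; first split.
- by move=> N [[[N1 _ _] _] _].
- move=> x y Nx Ny N NA.
  by case: (NA) => [[[_ NM _] _] _]; apply: NM; [apply: Nx | apply: Ny].
- by move=> x Nx N NA; case: (NA) => [[[_ _ NV] _] _]; apply: NV; apply: Nx.
- by move=> x g Nx N NA; case: (NA) => [[_ NJ] _]; apply: NJ; apply: Nx.
Qed.

Lemma gen_byP (A : set G) : is_subgroup (gen_by A).
Proof.
split.
- by move=> H [[H1 _ _] _].
- move=> x y Hx Hy H HA.
  by case: (HA) => [[_ HM _] _]; apply: HM; [apply: Hx | apply: Hy].
- by move=> x Hx H HA; case: (HA) => [[_ _ HV] _]; apply: HV; apply: Hx.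
Qed.

Lemma gen_by_sub (A : set G) : A `<=` gen_by A.
Proof. by move=> x Ax H [_]; apply. Qed.

Lemma commutator_subgroup_normal (A B : set G) :
  (forall x g, A x -> A (x ^ g)) -> (forall x g, B x -> B (x ^ g)) ->
  is_normal (commutator_subgroup A B).
Proof.
move=> AJ BJ; split; first exact: gen_byP.
move=> x g; have [g1 gM gV] := gen_byP [set [~ a, b] | a in A & b in B].
apply: (_ : gen_by _ `<=` [set x | commutator_subgroup A B (x ^ g)]).
apply: smallest_sub.
  split=> [|y z /= Hy Hz|y /= Hy]; first by rewrite /= conj1g.
    by rewrite conjMg; apply: gM.
  by rewrite conjVg; apply: gV.
move=> _ [a Aa [b Bb <-]] /=; rewrite conjRg; apply: gen_by_sub.
by exists (a ^ g); [apply: AJ | exists (b ^ g); [apply: BJ|]].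
Qed.

(* Shifted index: the value at [0] is also [setT], as at [1]. *)
Definition lower_central_set (m : nat) : set G :=
  iter m.-1 (fun H => commutator_subgroup H setT) setT.

Lemma lower_central_setP m : is_normal (lower_central_set m).
Proof.
rewrite /lower_central_set; elim: m.-1 => [//|k [_ IHk]] /=.
exact: commutator_subgroup_normal.
Qed.

Definition lower_central (m : nat) : normal_subgroup :=
  NormalSubgroup (lower_central_setP m).

End Subgroups.

Section Quotient.
Variables (G : groupType) (N : normal_subgroup G).

Definition coset_rel : rel G := fun x y => `[< normal_set N (x^-1 * y) >].

Lemma coset_rel_refl : reflexive coset_rel.
Proof.
by move=> x; apply/asboolP; rewrite mulVg; case: (normal_setP N) => -[].
Qed.

Lemma coset_rel_sym : symmetric coset_rel.
Proof.
have [[_ _ NV] _] := normal_setP N.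
move=> x y; apply/asboolP/asboolP => /NV; rewrite invgM invgK; exact.
Qed.

Lemma coset_rel_trans : transitive coset_rel.
Proof.
have [[_ NM _] _] := normal_setP N.
move=> y x z /asboolP Nxy /asboolP Nyz; apply/asboolP.
by move: (NM _ _ Nxy Nyz); rewrite mulgA mulgK.
Qed.

Canonical coset_equiv := EquivRel coset_rel
  coset_rel_refl coset_rel_sym coset_rel_trans.

Definition coset_group := {eq_quot coset_equiv}%qT.
HB.instance Definition _ := Choice.on coset_group.

Definition qproj (x : G) : coset_group := (\pi_({eq_quot coset_equiv}) x)%qT.
Definition qone : coset_group := qproj 1.
Definition qinv (a : coset_group) : coset_group := qproj (repr a)^-1.
Definition qmul (a b : coset_group) : coset_group :=
  qproj (repr a * repr b).

Lemma qprojP x y : reflect (qproj x = qproj y) (coset_rel x y).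
Proof. exact: (@eqmodP _ coset_equiv). Qed.

Lemma qreprK a : qproj (repr a) = a.
Proof. exact: reprK. Qed.

Lemma qproj_mul x y : qmul (qproj x) (qproj y) = qproj (x * y).
Proof.
have [[_ NM _] NJ] := normal_setP N.
rewrite /qmul; apply/qprojP.
have /qprojP/asboolP Nx := qreprK (qproj x).
have /qprojP/asboolP Ny := qreprK (qproj y).
apply/asboolP.
move: (NM _ _ (NJ _ (repr (qproj y)) Nx) Ny).
by rewrite /conjg invgM !mulgA mulgK.
Qed.

Lemma qproj_inv x : qinv (qproj x) = qproj x^-1.
Proof.
have [[_ _ NV] NJ] := normal_setP N.
rewrite /qinv; apply/qprojP; have /qprojP/asboolP Nx := qreprK (qproj x).
apply/asboolP; rewrite invgK.
move: (NJ _ (repr (qproj x))^-1 (NV _ Nx)).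
by rewrite /conjg invgK invgM invgK -!mulgA mulgV mulg1.
Qed.

Lemma qmulA : associative qmul.
Proof.
move=> a b c; rewrite -(qreprK a) -(qreprK b) -(qreprK c).
by rewrite !qproj_mul mulgA.
Qed.

Lemma qmul1g : left_id qone qmul.
Proof. by move=> a; rewrite -(qreprK a) qproj_mul mul1g. Qed.

Lemma qmulg1 : right_id qone qmul.
Proof. by move=> a; rewrite -(qreprK a) qproj_mul mulg1. Qed.

Lemma qmulVg : left_inverse qone qinv qmul.
Proof. by move=> a; rewrite -(qreprK a) qproj_inv qproj_mul mulVg. Qed.

Lemma qmulgV : right_inverse qone qinv qmul.
Proof. by move=> a; rewrite -(qreprK a) qproj_inv qproj_mul mulgV. Qed.

HB.instance Definition _ := isGroup.Build coset_group
  qmulA qmul1g qmulg1 qmulVg qmulgV.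

End Quotient.

(* In a word, the letter [(x, true)] stands for [x] and [(x, false)] for its
   inverse. *)
Section FreeGroup.
Variable X : choiceType.

Inductive free_conv : seq (X * bool) -> seq (X * bool) -> Prop :=
| free_conv_cancel u v x b :
    free_conv (u ++ [:: (x, b); (x, ~~ b)] ++ v) (u ++ v)
| free_conv_refl u : free_conv u u
| free_conv_sym u v : free_conv u v -> free_conv v u
| free_conv_trans v u w : free_conv u v -> free_conv v w -> free_conv u w.

Definition free_rel : rel (seq (X * bool)) := fun u v => `[< free_conv u v >].

Lemma free_rel_refl : reflexive free_rel.
Proof. by move=> u; apply/asboolP/free_conv_refl. Qed.

Lemma free_rel_sym : symmetric free_rel.
Proof. by move=> u v; apply/asboolP/asboolP => /free_conv_sym. Qed.

Lemma free_rel_trans : transitive free_rel.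
Proof.
move=> v u w /asboolP uv /asboolP vw; apply/asboolP.
exact: free_conv_trans uv vw.
Qed.

Canonical free_equiv := EquivRel free_rel
  free_rel_refl free_rel_sym free_rel_trans.

Definition free_group := {eq_quot free_equiv}%qT.
HB.instance Definition _ := Choice.on free_group.

Definition fproj (u : seq (X * bool)) : free_group :=
  (\pi_({eq_quot free_equiv}) u)%qT.

Definition invw (u : seq (X * bool)) : seq (X * bool) :=
  rev [seq (a.1, ~~ a.2) | a <- u].

Definition fone : free_group := fproj [::].
Definition finvg (a : free_group) : free_group := fproj (invw (repr a)).
Definition fmulg (a b : free_group) : free_group := fproj (repr a ++ repr b).

Lemma fprojP u v : (fproj u = fproj v) <-> free_conv u v.
Proof.
split; first by move/(@eqmodP _ free_equiv)/asboolP.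
by move=> uv; apply/(@eqmodP _ free_equiv)/asboolP.
Qed.

Lemma freprK a : fproj (repr a) = a.
Proof. exact: reprK. Qed.

Lemma free_conv_ctx l r u v :
  free_conv u v -> free_conv (l ++ u ++ r) (l ++ v ++ r).
Proof.
elim=> {u v} [u v x b|u|u v _|v u w _ uv _ vw].
- by move: (free_conv_cancel (l ++ u) (v ++ r) x b); rewrite -!catA.
- exact: free_conv_refl.
- exact: free_conv_sym.
- exact: free_conv_trans uv vw.
Qed.

Lemma free_conv_cat u u' v v' :
  free_conv u u' -> free_conv v v' -> free_conv (u ++ v) (u' ++ v').
Proof.
move=> /(free_conv_ctx [::] v) /= uu' /(free_conv_ctx u' [::]).
by rewrite !cats0; apply: free_conv_trans uu'.
Qed.

Lemma free_conv_inv u v : free_conv u v -> free_conv (invw u) (invw v).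
Proof.
elim=> {u v} [u v x b|u|u v _|v u w _ uv _ vw].
- rewrite /invw !map_cat !rev_cat -catA.
  by have := free_conv_cancel (invw v) (invw u) x b; rewrite /invw /= negbK.
- exact: free_conv_refl.
- exact: free_conv_sym.
- exact: free_conv_trans uv vw.
Qed.

Lemma free_conv_mulV u : free_conv (u ++ invw u) [::].
Proof.
elim: u => [|[x b] u IHu]; first exact: free_conv_refl.
rewrite /invw /= rev_cons -cats1 -cat1s catA -catA.
have := free_conv_ctx [:: (x, b)] [:: (x, ~~ b)] IHu.
rewrite -!catA => /free_conv_trans; apply.
exact: (free_conv_cancel [::] [::]).
Qed.

Lemma invwK : involutive invw.
Proof.
move=> u; rewrite /invw map_rev revK -map_comp -[RHS]map_id.
by apply: eq_map => -[x b] /=; rewrite negbK.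
Qed.

Lemma fproj_mul u v : fmulg (fproj u) (fproj v) = fproj (u ++ v).
Proof. by apply/fprojP/free_conv_cat; apply/fprojP; rewrite freprK. Qed.

Lemma fproj_inv u : finvg (fproj u) = fproj (invw u).
Proof. by apply/fprojP/free_conv_inv; apply/fprojP; rewrite freprK. Qed.

Lemma fmulA : associative fmulg.
Proof.
move=> a b c; rewrite -(freprK a) -(freprK b) -(freprK c).
by rewrite !fproj_mul catA.
Qed.

Lemma fmul1g : left_id fone fmulg.
Proof. by move=> a; rewrite -(freprK a) fproj_mul. Qed.

Lemma fmulg1 : right_id fone fmulg.
Proof. by move=> a; rewrite -(freprK a) fproj_mul cats0. Qed.

Lemma fmulgV : right_inverse fone finvg fmulg.
Proof.
move=> a; rewrite -(freprK a) fproj_inv fproj_mul.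
exact/fprojP/free_conv_mulV.
Qed.

Lemma fmulVg : left_inverse fone finvg fmulg.
Proof.
move=> a; rewrite -(freprK a) fproj_inv fproj_mul.
by apply/fprojP; rewrite -{2}(invwK (repr a)); apply: free_conv_mulV.
Qed.

HB.instance Definition _ := isGroup.Build free_group
  fmulA fmul1g fmulg1 fmulVg fmulgV.

Definition fgen (x : X) : free_group := fproj [:: (x, true)].

End FreeGroup.

(* [rels u v] is the defining relation [u = v]. *)
Section Presentation.
Variables (X : choiceType) (rels : free_group X -> free_group X -> Prop).

Definition relators : set (free_group X) :=
  [set w | exists u v, rels u v /\ w = u * v^-1].

Definition relator_subgroup : normal_subgroup (free_group X) :=
  NormalSubgroup (normal_closureP relators).

Definition presented_group := coset_group relator_subgroup.
HB.instance Definition _ := Group.on presented_group.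

Definition pgen (x : X) : presented_group := qproj relator_subgroup (fgen x).

End Presentation.

Definition isomorphic (G H : groupType) : Prop :=
  exists f : {multiplicative G -> H}, bijective f.

Definition nat_itv (p q : nat) : set nat := [set k | (p <= k <= q)%N].

(* The index [x] with [val x = (p, q)] names the generator [sigma_{p,q}]; an
   element [i] of [sigma_index] names [sigma_i = sigma_{1,i}]. *)
Section Cactus.
Variable n : nat.

Definition cactus_index :=
  {pq : nat * nat | [&& 1 <= pq.1, pq.1 < pq.2 & pq.2 <= n]%N}.

Local Notation s := (@fgen cactus_index).

Inductive cactus_relation :
  free_group cactus_index -> free_group cactus_index -> Prop :=
| cactus_involution (x : cactus_index) : cactus_relation (s x ^+ 2) 1
| cactus_disjoint (x y : cactus_index) (p q r t : nat) :
    val x = (p, q) -> val y = (r, t) ->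
    nat_itv p q `&` nat_itv r t = set0 ->
    cactus_relation (s x * s y) (s y * s x)
| cactus_nested (x y z : cactus_index) (p q r t : nat) :
    val x = (p, q) -> val y = (r, t) -> nat_itv r t `<=` nat_itv p q ->
    val z = (p + q - t, p + q - r)%N ->
    cactus_relation (s x * s y) (s z * s x).

Definition cactus_group := presented_group cactus_relation.
HB.instance Definition _ := Group.on cactus_group.

Definition sigma_index := {i : nat | (2 <= i <= n)%N}.

Definition cactus_index_of (i : sigma_index) : cactus_index :=
  exist _ (1%N, val i) (valP i).

Definition cactus_sigma (i : sigma_index) : cactus_group :=
  pgen cactus_relation (cactus_index_of i).

Local Notation g := (@fgen sigma_index).

Inductive cactus_nil2_relation :
  free_group sigma_index -> free_group sigma_index -> Prop :=
| nil2_involution (i : sigma_index) : cactus_nil2_relation (g i ^+ 2) 1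
| nil2_commute (i j : sigma_index) :
    (val i < (n + 1) %/ 2)%N \/ (val j = val i %[mod 2])%N ->
    cactus_nil2_relation [~ g i, g j] 1
| nil2_central (i j k : sigma_index) :
    cactus_nil2_relation [~ g i, g j, g k] 1
| nil2_parity (i j k : sigma_index) :
    (val i <= val j)%N -> (val i <= val k)%N -> (val k = val j %[mod 2])%N ->
    cactus_nil2_relation [~ g i, g j] [~ g i, g k].

End Cactus.

(* The multiplicative [finGroupType] structure on ['Z_2] is its addition. *)
Section Wreath.
Variable gT : finGroupType.

Definition swap_act (x : gT * gT) (a : 'Z_2) : gT * gT :=
  if a == 1 then x else (x.2, x.1).

Lemma swap_act1 : swap_act^~ 1 =1 id.
Proof. by move=> x; rewrite /swap_act eqxx. Qed.

Lemma swap_actM x : act_morph swap_act x.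
Proof.
rewrite /swap_act => a b; case: x => x y.
by case: a => -[|[|//]] ?; case: b => -[|[|//]] ?.
Qed.

Canonical swap_action := TotalAction swap_act1 swap_actM.

Lemma swap_is_groupAction : is_groupAction [set: gT * gT]%SET swap_action.
Proof.
move=> a _ /=; rewrite inE; apply/andP; split.
  by apply/fintype.subsetP => x _; rewrite inE.
apply/morphicP => x y _ _; rewrite !actpermE /= /swap_act.
by case: ifP.
Qed.

Canonical swap_groupAction := GroupAction swap_is_groupAction.

Definition wreath2 := sdprod_by swap_groupAction.
HB.instance Definition _ := FinGroup.on wreath2.

End Wreath.

(* Main.v *)
From HB Require Import structures.
Require Import Defs.
From mathcomp Require Import all_boot all_fingroup zmodp.
From mathcomp Require Import ssralg zify.
From mathcomp Require Import generic_quotient boolp classical_sets cardinality.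

(** Write [t i] for [sigma_{1,i}].  Conjugating by [sigma_{1,q}] shows that
[sigma_{p,q} = t q * t (q - p + 1) * t q], so the [t i] generate, and in a
group of class at most two, where commutators are central,
[sigma_{p,q} = t m * [~ t m, t q]] with [m = q - p + 1].  Substituting these
expressions turns every cactus relation into a relation between commutators:
nested intervals give [[~ t k, t m.+1] = [~ t k, t m] * [~ t k, t k.+1]], and as
the [t i] are involutions this says that [[~ t k, t m]], for [k <= m], is
[[~ t k, t k.+1]] or [1] according to the parity of [m - k].  Disjoint intervals
of lengths [k] and [k + 1] exist exactly when [2 k + 1 <= n], and they kill
[[~ t k, t k.+1]].  Conversely, these facts on commutators imply all the cactus
relations.  Hence, in a class-two group, elements [sigma_{p,q}] that satisfy the
cactus relations amount to elements [t i] that satisfy the nilpotent relations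
([nil2_family_cactus], [cactus_family_nil2]), and the universal properties of
both groups give inverse isomorphisms ([cactus_nil2_presentation]).

For the order, the commutators [[~ t k, t k.+1]] that survive have
[(n + 1) %/ 2 <= k < n], so there are [n %/ 2] of them.  Collecting shows that
every element is a product of the [n - 1] generators followed by these central
involutions, each with exponent 0 or 1 ([nil2_normal_form_onto]).  There are no
further coincidences, because the presented group maps to the central
extension of one elementary abelian 2-group by another defined by the bilinear
form that the commutators dictate, and the normal form with exponents [(x, z)]
is sent to the pair [(x, z)] itself ([model_normal_form]).

More generally, a morphism out of the presented group is bijective as soon as
it is bijective on normal forms ([nil2_mult_bijective]).  For [n = 4] send
[t 3] to the swap and [t 2], [t 4] to the two generators of one factor
[Z_2 ^ 2]; for [n = 5] the generator [t 2] is central and splits off, and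
[t 3], [t 4], [t 5] play the previous roles. *)

Set Implicit Arguments.
Unset Strict Implicit.
Unset Printing Implicit Defensive.

Local Open Scope classical_set_scope.
Local Open Scope group_scope.

(** * Groups of class at most two *)

Definition central (G : groupType) (c : G) := forall x, commute c x.

Section Class2.
Variable G : groupType.

Definition nilp2 := forall x y z : G, [~ x, y, z] = 1.

Hypothesis G2 : nilp2.
Implicit Types x y z : G.

Lemma commg_central x y : central [~ x, y].
Proof. by move=> z; apply/commgP/eqP/G2. Qed.

(** The conjugation in the general formula for [[~ x * y, z]] acts trivially on
a central commutator. *)
Lemma commMg2 x y z : [~ x * y, z] = [~ x, z] * [~ y, z].
Proof.
have -> : [~ x * y, z] = [~ x, z] ^ y * [~ y, z].
  by rewrite !commgEl !conjgE !gnorm.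
by congr (_ * _); apply/conjg_fixP/eqP/G2.
Qed.

Lemma commg_sqr x y : x * x = 1 -> [~ x, y] * [~ x, y] = 1.
Proof. by move=> xx; rewrite -commMg2 xx comm1g. Qed.

Lemma commg_symm x y : x * x = 1 -> [~ x, y] = [~ y, x].
Proof. by move=> xx; rewrite -(invgR x y); apply/esym/mulg1_eq/commg_sqr. Qed.

(** With [x], [y] generators of the form [t i] and [z], [u], [v] commutators,
this reduces a cactus relation to an identity between commutators: the central
factors move to the right, and exchanging [x] and [y] costs [[~ x, y]]. *)
Lemma commg_exchange x y z u v :
    central z -> central u -> central v ->
  (x * z) * (y * u) = (y * v) * (x * z) <-> [~ x, y] * u = v.
Proof.
move=> zC uC vC.
have -> : (x * z) * (y * u) = y * x * z * ([~ x, y] * u).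
  rewrite [RHS]mulgA -(mulgA (y * x)) (zC [~ x, y]) (mulgA (y * x)) -commgC.
  by rewrite -!mulgA (mulgA z) zC !mulgA.
have -> : (y * v) * (x * z) = y * x * z * v.
  by rewrite -(mulgA y) vC !mulgA.
by split=> [/mulgI|->].
Qed.

End Class2.

(** It rewrites [sigma_{p,q} = t q * t m * t q] in the form that
[commg_exchange] expects. *)
Lemma invol_conj (G : groupType) (x y : G) : y * y = 1 -> y * x * y = x * [~ x, y].
Proof. by move/mulg1_eq=> yV; rewrite commgEl conjgE !gnorm yV. Qed.

(** * From the cactus relations to commutators and back *)

Section Families.
Variables (n : nat) (G : groupType).

(** Indexing by natural numbers, rather than by the generators themselves, allows
arithmetic on indices without carrying membership proofs. *)
Record cactus_family (s : nat -> nat -> G) : Prop := CactusFamily {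
  cactus_inv : forall p q, (1 <= p < q)%N -> (q <= n)%N -> s p q * s p q = 1;
  cactus_disj : forall p q r t, (1 <= p < q)%N -> (q < r < t)%N -> (t <= n)%N ->
    commute (s p q) (s r t);
  cactus_nest : forall p q r t, (1 <= p <= r)%N -> (r < t <= q)%N -> (q <= n)%N ->
    s p q * s r t = s (p + q - t) (p + q - r) * s p q }.

Record nil2_family (t : nat -> G) : Prop := Nil2Family {
  nil2_inv : forall i, (2 <= i <= n)%N -> t i * t i = 1;
  nil2_comm : forall i j, (2 <= i <= n)%N -> (2 <= j <= n)%N ->
    (i < (n + 1) %/ 2)%N \/ (j = i %[mod 2])%N -> [~ t i, t j] = 1;
  nil2_centr : forall i j k, (2 <= i <= n)%N -> (2 <= j <= n)%N -> (2 <= k <= n)%N ->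
    [~ t i, t j, t k] = 1;
  nil2_par : forall i j k, (2 <= i)%N -> (i <= j <= n)%N -> (i <= k <= n)%N ->
    (k = j %[mod 2])%N -> [~ t i, t j] = [~ t i, t k] }.

Hypothesis G2 : nilp2 G.

Section FromCactus.
Variables (s : nat -> nat -> G) (sP : cactus_family s).
Local Notation t := (s 1).

(** The relation for [[r, u]] nested in [[1, u]], with [sigma_{1,u}] an
involution. *)
Lemma cactus_conj r u : (1 <= r < u)%N -> (u <= n)%N ->
  s r u = t u * t (u - r + 1) * t u.
Proof.
move=> ru un; have tu := cactus_inv sP (p := 1) (q := u).
apply: (mulgI (t u)); rewrite 2!mulgA tu; [|lia|lia].
rewrite mul1g (cactus_nest sP); [|lia|lia|lia].
by congr (s _ _ * _); lia.
Qed.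

Lemma cactus_comm r u : (1 <= r < u)%N -> (u <= n)%N ->
  s r u = t (u - r + 1) * [~ t (u - r + 1), t u].
Proof.
move=> ru un; rewrite cactus_conj// invol_conj//; apply: (cactus_inv sP); lia.
Qed.

(** This is the nested relation for [[m - k + 2, m + 1]] in [[2, m + 1]]: the
inner interval, of length [k], is reflected to [[2, k + 1]]. *)
Lemma cactus_commS k m : (2 <= k <= m)%N -> (m < n)%N ->
  [~ t k, t m.+1] = [~ t k, t m] * [~ t k, t k.+1].
Proof.
move=> km mn; have C := commg_central G2.
have := cactus_nest sP (p := 2) (q := m.+1) (r := m - k + 2) (t := m.+1).
have -> : (2 + m.+1 - m.+1 = 2)%N by lia.
have -> : (2 + m.+1 - (m - k + 2) = k.+1)%N by lia.
rewrite (@cactus_comm 2 m.+1) 1?(@cactus_comm (m - k + 2)) 1?(@cactus_comm 2 k.+1);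
  try lia.
have -> : (m.+1 - 2 + 1 = m)%N by lia.
have -> : (m.+1 - (m - k + 2) + 1 = k)%N by lia.
have -> : (k.+1 - 2 + 1 = k)%N by lia.
have tm : t m * t m = 1 by apply: (cactus_inv sP); lia.
move=> H; have {H} : [~ t m, t k] * [~ t k, t m.+1] = [~ t k, t k.+1].
  by apply/(commg_exchange _ _ (C _ _) (C _ _) (C _ _))/H; lia.
by move=> <-; rewrite -(commg_symm G2 _ tm) mulgA commg_sqr// mul1g.
Qed.

(** By [cactus_commS] the commutator is the [(m - k)]-th power of
[[~ t k, t k.+1]], which is an involution. *)
Lemma cactus_comm_parity k m : (2 <= k <= m)%N -> (m <= n)%N ->
  [~ t k, t m] = if odd (m - k) then [~ t k, t k.+1] else 1.
Proof.
move=> km mn; have -> : m = (k + (m - k))%N by lia.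
have : (k + (m - k) <= n)%N by lia.
have -> : (k + (m - k) - k = m - k)%N by lia.
elim: (m - k)%N => [|d IHd] dn; first by rewrite addn0 commgg.
rewrite addnS cactus_commS; try lia.
rewrite IHd /=; last lia.
case: odd; last by rewrite mul1g.
rewrite commg_sqr//; apply: (cactus_inv sP); lia.
Qed.

(** The intervals [[1, k]] and [[k + 1, 2 k + 1]] are disjoint, and their
generators are [t k] and [t k.+1] up to a central factor. *)
Lemma cactus_comm_small k : (2 <= k)%N -> (k.*2 < n)%N -> [~ t k, t k.+1] = 1.
Proof.
move=> k2 kn; have := cactus_disj sP (p := 1) (q := k) (r := k.+1) (t := k.*2.+1).
move=> H; apply/eqP/commgP.
have {H} : commute (t k) (s k.+1 k.*2.+1) by apply: H; lia.
rewrite (@cactus_comm k.+1); try lia.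
have -> : (k.*2.+1 - k.+1 + 1 = k.+1)%N by lia.
set c := [~ _, t k.*2.+1] => tkC; rewrite -[t k.+1](mulgK c).
by apply: commuteM => //; apply/commuteV/commute_sym/(commg_central G2).
Qed.

Lemma nil2_family_cactus : nil2_family t.
Proof.
split.
- by move=> i ?; apply: (cactus_inv sP); lia.
- move=> i j i2 j2 ij.
  wlog le_ij : i j i2 j2 ij / (i <= j)%N.
    move=> W; case: (leqP i j) => [|ji]; first exact: W.
    rewrite -invgR W ?invg1//; last lia.
    by case: ij => ?; [left|right]; lia.
  rewrite cactus_comm_parity; try lia.
  case: ifP => // oij; apply: cactus_comm_small; lia.
- by move=> *; apply: G2.
- move=> i j k i2 ij ik jk.
  rewrite (@cactus_comm_parity i j) 1?(@cactus_comm_parity i k); try lia.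
  by have -> : odd (k - i) = odd (j - i) by lia.
Qed.

End FromCactus.

Section ToCactus.
Variables (t : nat -> G) (tP : nil2_family t).

(** The only possible value of [sigma_{p,q}], by [cactus_conj]. *)
Definition sigma_of p q := t q * t (q - p + 1) * t q.

Lemma sigma_ofE p q : (1 <= p < q)%N -> (q <= n)%N ->
  sigma_of p q = t (q - p + 1) * [~ t (q - p + 1), t q].
Proof.
move=> pq qn; apply: invol_conj; apply: (nil2_inv tP); lia.
Qed.

Lemma nil2_comm_parity k m : (2 <= k <= m)%N -> (m <= n)%N ->
  [~ t k, t m] = if odd (m - k) then [~ t k, t k.+1] else 1.
Proof.
move=> km mn; case: ifP => o; first by apply: (nil2_par tP); lia.
by apply: (nil2_comm tP); lia.
Qed.

(** By [commg_exchange] only commutators remain to be compared.  For disjoint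
intervals the smaller length [k] satisfies [2 k < n] unless both lengths are
equal, so the generators commute.  For [[r, u]] nested in [[p, q]], of lengths
[k] and [m], the claim is
[[~ t k, t m] * [~ t k, t u] = [~ t k, t (p + q - r)]], which holds because the
exponents of [[~ t k, t k.+1]] agree modulo 2. *)
Lemma cactus_family_nil2 : cactus_family sigma_of.
Proof.
have C := commg_central G2.
have tI i : (2 <= i <= n)%N -> t i * t i = 1 by apply: (nil2_inv tP).
split.
- move=> p q pq qn; rewrite /sigma_of -!mulgA (mulgA (t q) (t q)) tI ?mul1g; last lia.
  by rewrite (mulgA (t (q - p + 1))) tI ?mul1g ?tI //; lia.
- move=> p q r u pq qr un; rewrite !sigma_ofE; try lia.
  apply/(commg_exchange _ _ (C _ _) (C _ _) (C _ _)).
  rewrite (_ : [~ t (q - p + 1), t (u - r + 1)] = 1) ?mul1g//.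
  set k := (q - p + 1)%N; set m := (u - r + 1)%N.
  have [km|mk] : (k <= m)%N \/ (m < k)%N by lia.
    by rewrite nil2_comm_parity; try lia; case: ifP => // o; apply: (nil2_comm tP); lia.
  rewrite -invgR nil2_comm_parity; try lia; case: ifP => o; rewrite ?invg1//.
  by rewrite (nil2_comm tP) ?invg1//; lia.
- move=> p q r u pr ru qn; rewrite !sigma_ofE; try lia.
  have -> : (p + q - r - (p + q - u) + 1 = u - r + 1)%N by lia.
  apply/(commg_exchange _ _ (C _ _) (C _ _) (C _ _)).
  set m := (q - p + 1)%N; set k := (u - r + 1)%N.
  have tm : t m * t m = 1 by apply: tI; lia.
  rewrite (commg_symm G2 _ tm).
  rewrite (@nil2_comm_parity k m) 1?(@nil2_comm_parity k u)
    1?(@nil2_comm_parity k (p + q - r)); try lia.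
  have a2 : [~ t k, t k.+1] * [~ t k, t k.+1] = 1 by rewrite commg_sqr// tI//; lia.
  have -> : odd (p + q - r - k) = odd (m - k) (+) odd (u - k) by lia.
  by case: (odd (m - k)); case: (odd (u - k)); rewrite ?mul1g ?mulg1.
Qed.

End ToCactus.
End Families.

(** * Morphisms, generating sets and quotients *)

Lemma bijective_inj_surj (T U : choiceType) (f : T -> U) :
  injective f -> (forall y, exists x, f x = y) -> bijective f.
Proof.
move=> f_inj /boolp.choice [g fg]; exists g => // x.
exact/f_inj/fg.
Qed.

Lemma card_bijective (T : choiceType) (U : finType) (f : T -> U) :
  bijective f -> ([set: T] #= `I_#|U|)%card.
Proof.
move=> [g fK gK]; apply/card_set_bijP; exists (fun x => val (enum_rank (f x))); split.
- by move=> x _ /=.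
- by move=> x y _ _ /val_inj/enum_rank_inj/(can_inj fK).
- move=> k /= ltk; exists (g (enum_val (Ordinal ltk))) => //.
  by rewrite /= gK enum_valK.
Qed.

Lemma isomorphic_bijective (P G H : groupType)
    (f : {multiplicative P -> G}) (g : {multiplicative P -> H}) :
  bijective f -> bijective g -> isomorphic G H.
Proof.
move=> [f' fK f'K] g_bij.
have gM : {morph g \o f' : x y / x * y}.
  by move=> x y /=; rewrite -gmulfM; congr (g _); apply: (can2_gmulfM fK f'K).
pose m := isMultiplicative.Build G H (g \o f') gM.
pose F : {multiplicative G -> H} := HB.pack (g \o f') m.
exists F; apply: (bij_comp g_bij); exists f => //.
Qed.

Section MultiplicativeTheory.
Variables (G H : groupType) (f : {multiplicative G -> H}).

Lemma mult1 : f 1 = 1.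
Proof. by apply: (mulgI (f 1)); rewrite -gmulfM !mulg1. Qed.

Lemma multV x : f x^-1 = (f x)^-1.
Proof. by apply/esym/mulg1_eq; rewrite -gmulfM mulgV mult1. Qed.

Lemma multR x y : f [~ x, y] = [~ f x, f y].
Proof. by rewrite !gmulfM !multV. Qed.

Lemma multJ x y : f (x ^ y) = f x ^ f y.
Proof. by rewrite !gmulfM multV. Qed.

End MultiplicativeTheory.

Section Generated.
Variables (G : groupType) (S : set G).
Hypothesis genS : forall x, gen_by S x.

Lemma subgroup_full (K : set G) : is_subgroup K -> S `<=` K -> forall x, K x.
Proof. by move=> Kg SK x; apply: smallest_sub Kg SK _ (genS x). Qed.

Lemma central_subgroup : is_subgroup (@central G).
Proof.
split=> [x|c d cC dC x|c cC x]; first exact/commute_sym/commute1.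
  exact/commute_sym/(commuteM (commute_sym (cC x)) (commute_sym (dC x))).
exact/commute_sym/commuteV/commute_sym/cC.
Qed.

Lemma central_gen c : (forall x, S x -> commute c x) -> central c.
Proof.
apply: subgroup_full; split=> [|x y|x]; first exact: commute1.
  exact: commuteM.
exact: commuteV.
Qed.

(** The [y] with central [[~ x, y]] form a subgroup. *)
Lemma central_commg x :
  (forall y, S y -> central [~ x, y]) -> forall y, central [~ x, y].
Proof.
have [C1 CM CV] := central_subgroup.
have CJ c z : central c -> c ^ z = c by move=> cC; apply/conjg_fixP/commgP/cC.
apply: subgroup_full; split=> [|y z Cy Cz|y Cy] /=; first by rewrite commg1.
  have -> : [~ x, y * z] = [~ x, z] * [~ x, y] ^ z.
    by rewrite !commgEl !conjgE !gnorm.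
  by rewrite CJ//; apply: CM.
have -> : [~ x, y^-1] = ([~ x, y]^-1) ^ y^-1.
  by rewrite !commgEl !conjgE !gnorm.
by rewrite CJ; apply: CV.
Qed.

(** [central_commg] is applied twice: from generators to an arbitrary second
argument, and then, after exchanging the arguments, to an arbitrary first
argument. *)
Lemma nilp2_generated :
  (forall x y z, S x -> S y -> S z -> [~ x, y, z] = 1) -> nilp2 G.
Proof.
have [_ _ CV] := central_subgroup.
move=> S2 x y z; apply/eqP/commgP; move: z; apply: central_commg => {}y Sy.
rewrite -invgR; apply: CV; move: x; apply: central_commg => x Sx.
by apply: central_gen => z Sz; apply/commgP/eqP/S2.
Qed.

End Generated.

Section Lift.
Variables (G H : groupType) (N : normal_subgroup G) (f : {multiplicative G -> H}).
Hypothesis fN : forall x, normal_set N x -> f x = 1.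

Definition coset_lift_fun (a : coset_group N) : H := f (repr a).

Lemma coset_lift_proj x : coset_lift_fun (qproj N x) = f x.
Proof.
have /qprojP/asboolP/fN := qreprK (qproj N x).
by rewrite gmulfM multV /coset_lift_fun => /mulg1_eq; rewrite invgK.
Qed.

Fact coset_lift_morph : {morph coset_lift_fun : a b / a * b}.
Proof.
by move=> a b; rewrite {1}/coset_lift_fun [LHS]coset_lift_proj gmulfM.
Qed.

HB.instance Definition _ :=
  isMultiplicative.Build (coset_group N) H coset_lift_fun coset_lift_morph.

Lemma coset_lift : exists g : {multiplicative coset_group N -> H},
  forall x, g (qproj N x) = f x.
Proof. by exists coset_lift_fun; apply: coset_lift_proj. Qed.

End Lift.

Section Proj.
Variables (G : groupType) (N : normal_subgroup G).
Fact qproj_morph : {morph qproj N : x y / x * y}.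
Proof. by move=> x y; rewrite -qproj_mul. Qed.
HB.instance Definition _ :=
  isMultiplicative.Build G (coset_group N) (qproj N) qproj_morph.

Lemma qproj_eq1 x : qproj N x = 1 <-> normal_set N x.
Proof.
have [[_ _ NV] _] := normal_setP N.
rewrite -[1]/(qproj N 1); split => [/qprojP/asboolP|Nx].
  by rewrite mulg1 => /NV; rewrite invgK.
by apply/qprojP/asboolP; rewrite mulg1; apply: NV.
Qed.

End Proj.

Section LowerCentral.
Variables (G H : groupType).

(** Images of commutators are central in [H], so the images of the commutators
that generate the third term are trivial. *)
Lemma lower_central3_ker (f : {multiplicative G -> H}) : nilp2 H ->
  forall x, normal_set (lower_central G 3) x -> f x = 1.
Proof.
move=> H2.
have kerP A (K : set H) : is_subgroup K -> A `<=` f @^-1` K -> gen_by A `<=` f @^-1` K.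
  move=> [K1 KM KV]; apply: smallest_sub; split=> [|x y|x] /=; first by rewrite mult1.
    by rewrite gmulfM; apply: KM.
  by rewrite multV; apply: KV.
have f2 : lower_central_set 2 `<=` f @^-1` (@central H).
  apply: kerP => [|_ [x _ [y _ <-]] z]; first exact: central_subgroup.
  by rewrite multR; apply: (commg_central H2).
apply: (kerP _ [set 1]); first split=> [//|x y /= -> ->|x /= ->].
- by rewrite mulg1.
- by rewrite invg1.
move=> _ [x /f2 fx [y _ <-]] /=.
by rewrite multR; apply/eqP/commgP.
Qed.

Lemma lower_central3_nilp2 : nilp2 (coset_group (lower_central G 3)).
Proof.
move=> a b c; rewrite -(qreprK a) -(qreprK b) -(qreprK c).
set f := qproj _; rewrite -(multR f (repr a)) -(multR f [~ repr a, repr b]).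
apply/qproj_eq1; apply: gen_by_sub; exists [~ repr a, repr b]; last by exists (repr c).
by apply: gen_by_sub; exists (repr a) => //; exists (repr b).
Qed.

End LowerCentral.

(** * Maps out of presented groups *)

Section FreeLift.
Variables (X : choiceType) (H : groupType) (f : X -> H).

Definition word_eval (u : seq (X * bool)) : H :=
  \prod_(a <- u) (if a.2 then f a.1 else (f a.1)^-1).

Lemma word_eval_cat u v : word_eval (u ++ v) = word_eval u * word_eval v.
Proof. exact: big_cat. Qed.

Lemma word_eval_conv u v : free_conv u v -> word_eval u = word_eval v.
Proof.
elim=> {u v} [u v x b|//|//|v u w _ -> _ -> //].
rewrite !word_eval_cat {2}/word_eval !big_cons big_nil mulg1 /=.
by case: b; rewrite ?mulVg ?mulgV mul1g.
Qed.

Definition free_lift_fun (a : free_group X) : H := word_eval (repr a).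

Lemma free_lift_proj u : free_lift_fun (fproj u) = word_eval u.
Proof. by apply: word_eval_conv; apply/fprojP; rewrite freprK. Qed.

Fact free_lift_morph : {morph free_lift_fun : a b / a * b}.
Proof.
by move=> a b; rewrite {1}/free_lift_fun [LHS]free_lift_proj word_eval_cat.
Qed.

HB.instance Definition _ :=
  isMultiplicative.Build (free_group X) H free_lift_fun free_lift_morph.

Lemma free_lift_gen x : free_lift_fun (fgen x) = f x.
Proof. by rewrite free_lift_proj /word_eval big_seq1. Qed.

End FreeLift.

Section PresentedLift.
Variables (X : choiceType) (rels : free_group X -> free_group X -> Prop).

(** The hypothesis quantifies over all extensions [F] of [f] to the free group so
that a relation can be checked using only that [F] is a morphism with known
values on the generators. *)
Lemma presented_lift (H : groupType) (f : X -> H) :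
    (forall F : {multiplicative free_group X -> H},
       (forall x, F (fgen x) = f x) -> forall u v, rels u v -> F u = F v) ->
  exists g : {multiplicative presented_group rels -> H},
    forall x, g (pgen rels x) = f x.
Proof.
move=> f_rels.
have [F FE] : exists F : {multiplicative free_group X -> H}, forall x, F (fgen x) = f x.
  by exists (free_lift_fun f); apply: free_lift_gen.
have FN : forall x, normal_set (relator_subgroup rels) x -> F x = 1.
  suff: normal_closure (relators rels) `<=` [set x | F x = 1] by [].
  apply: smallest_sub.
    split; first split.
    - exact: mult1.
    - by move=> x y /= Fx Fy; rewrite gmulfM Fx Fy mulg1.
    - by move=> x /= Fx; rewrite multV Fx invg1.
    - by move=> x g /= Fx; rewrite multJ Fx conj1g.
  move=> _ [u [v [uv ->]]] /=.
  by rewrite gmulfM multV (f_rels F FE _ _ uv) mulgV.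
have [g gP] := coset_lift FN; exists g => x.
by rewrite gP FE.
Qed.

Lemma pgen_rel u v : rels u v ->
  qproj (relator_subgroup rels) u = qproj (relator_subgroup rels) v.
Proof.
move=> uv; apply: divg1_eq; rewrite -multV -gmulfM; apply/qproj_eq1.
by move=> M [_]; apply; exists u, v.
Qed.

Lemma presented_ind (K : presented_group rels -> Prop) :
    K 1 -> (forall x a, K a -> K (pgen rels x * a)) ->
    (forall x a, K a -> K ((pgen rels x)^-1 * a)) -> forall a, K a.
Proof.
move=> K1 Kg KV a.
rewrite -(qreprK a) -(freprK (repr a)).
elim: (repr (repr a)) => [|[x b] w IHw]; first exact: K1.
rewrite -cat1s -fproj_mul -[fmulg _ _]/(fproj [:: (x, b)] * fproj w).
rewrite gmulfM.
case: b; first exact: Kg.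
rewrite -[fproj [:: _]]/(fproj (invw [:: (x, true)])) -fproj_inv.
rewrite -[finvg _]/((fproj [:: (x, true)])^-1).
rewrite (multV (qproj (relator_subgroup rels))).
exact: KV.
Qed.

Lemma presented_morph_ext (H : groupType)
    (f g : {multiplicative presented_group rels -> H}) :
  (forall x, f (pgen rels x) = g (pgen rels x)) -> f =1 g.
Proof.
move=> fg; apply: presented_ind => [|x a IH|x a IH]; first by rewrite !mult1.
  by rewrite !gmulfM fg IH.
by rewrite !gmulfM !multV fg IH.
Qed.

Lemma presented_gen a : gen_by (range (pgen rels)) a.
Proof.
have [g1 gM gV] := gen_byP (range (pgen rels)).
have gg x : gen_by (range (pgen rels)) (pgen rels x) by apply: gen_by_sub; exists x.
elim/presented_ind: a => // x a; first exact: gM.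
by move=> ?; apply: gM => //; apply: gV.
Qed.

Lemma presented_nilp2 :
  (forall x y z, [~ pgen rels x, pgen rels y, pgen rels z] = 1) ->
  nilp2 (presented_group rels).
Proof.
move=> gen2; apply: (nilp2_generated presented_gen).
by move=> _ _ _ [x _ <-] [y _ <-] [z _ <-]; apply: gen2.
Qed.

End PresentedLift.

(** * The presentation of the class-two quotient *)

Section Extend.
Variables (T : choiceType) (P : pred T) (G : groupType) (f : {x | P x} -> G).

(** It turns generators indexed by a subtype of the natural numbers, or of pairs of
them, into families indexed by arbitrary natural numbers. *)
Definition extend (a : T) : G := if insub a is Some x then f x else 1.

Lemma extendE x : extend (val x) = f x.
Proof. by rewrite /extend valK. Qed.

End Extend.

Section CactusLift.
Variables (n : nat) (G : groupType).
Local Notation pg := (pgen (@cactus_relation n)).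

Lemma cactus_lift (s : nat -> nat -> G) : cactus_family n s ->
  exists g : {multiplicative cactus_group n -> G},
    forall x, g (pg x) = s (val x).1 (val x).2.
Proof.
move=> sP; apply: presented_lift => F FE u v; case=> {u v}.
- move=> [[p q] /= pq]; rewrite expg2 gmulfM FE mult1 /=.
  by rewrite (cactus_inv sP) //; lia.
- move=> [[p q] /= pq] [[r t] /= rt] _ _ _ _ [<- <-] [<- <-] disj.
  rewrite !gmulfM !FE /=.
  have [qr|qr] := ltnP q r; first by apply: (cactus_disj sP); lia.
  have [tp|tp] := ltnP t p; first by apply/commute_sym/(cactus_disj sP); lia.
  suff : set0 (maxn p r) by [].
  by rewrite -disj /nat_itv; split => /=; lia.
- move=> [[p q] /= pq] [[r t] /= rt] [[p' q'] /= pq'] _ _ _ _ [<- <-] [<- <-] sub [Ep Eq].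
  rewrite !gmulfM !FE /= Ep Eq.
  have /(_ r) := sub; have /(_ t) := sub; rewrite /nat_itv /= => subt subr.
  apply: (cactus_nest sP); first [have := subr _; lia | have := subt _; lia | lia].
Qed.

Lemma cactus_indexP p q : (1 <= p < q)%N -> (q <= n)%N ->
  exists x : cactus_index n, val x = (p, q).
Proof.
move=> /andP[p1 pq] qn.
have Px : [&& 1 <= p, p < q & q <= n]%N by rewrite p1 pq.
by exists (exist _ (p, q) Px).
Qed.

Lemma cactus_generators (f : {multiplicative cactus_group n -> G}) :
  cactus_family n
    (fun p q => extend (fun x : cactus_index n => f (pg x)) (p, q)).
Proof.
have fM a b : f a * f b = f (a * b) by rewrite gmulfM.
split.
- move=> p q pq qn; have [x Ex] := cactus_indexP pq qn.
  have E : pg x * pg x = 1.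
    by have := pgen_rel (cactus_involution x); rewrite expg2 gmulfM mult1.
  by rewrite -Ex !extendE fM E mult1.
- move=> p q r t pq qr tn.
  have [|x Ex] := cactus_indexP pq; first lia.
  have [||y Ey] := @cactus_indexP r t; [lia|lia|].
  have E : pg x * pg y = pg y * pg x.
    have := pgen_rel (cactus_disjoint Ex Ey _); rewrite !gmulfM; apply.
    by rewrite -subset0 => k; rewrite /nat_itv /=; lia.
  by rewrite -Ex -Ey !extendE /commute !fM E.
- move=> p q r t pr rt qn.
  have [||x Ex] := @cactus_indexP p q; [lia|lia|].
  have [||y Ey] := @cactus_indexP r t; [lia|lia|].
  have [||z Ez] := @cactus_indexP (p + q - t) (p + q - r); [lia|lia|].
  have E : pg x * pg y = pg z * pg x.
    have := pgen_rel (cactus_nested Ex Ey _ Ez); rewrite !gmulfM; apply.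
    by move=> k; rewrite /nat_itv /=; lia.
  by rewrite -Ex -Ey -Ez !extendE !fM E.
Qed.

End CactusLift.

Section Nil2Lift.
Variable n : nat.
Local Notation g := (pgen (@cactus_nil2_relation n)).

Lemma nil2_lift (G : groupType) (t : nat -> G) : nil2_family n t ->
  exists f : {multiplicative presented_group (@cactus_nil2_relation n) -> G},
    forall i, f (g i) = t (val i).
Proof.
move=> tP; apply: (presented_lift (f := t \o val)) => F FE u v; case=> {u v}.
- move=> i; rewrite expg2 gmulfM !FE mult1 /=.
  exact: (nil2_inv tP) (valP i).
- move=> i j ij; rewrite multR mult1 !FE /=.
  exact: (nil2_comm tP) (valP i) (valP j) ij.
- move=> i j k; rewrite !multR mult1 !FE /=.
  exact: (nil2_centr tP) (valP i) (valP j) (valP k).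
- move=> [i vi] [j vj] [k vk] /= ij ik jk; rewrite !multR !FE /=.
  by apply: (nil2_par tP) => //; lia.
Qed.

Definition nil2_gen : nat -> presented_group (@cactus_nil2_relation n) :=
  extend (fun i : sigma_index n => g i).

Lemma sigma_indexP i : (2 <= i <= n)%N -> exists a : sigma_index n, val a = i.
Proof. by move=> i2n; exists (exist _ i i2n). Qed.

Lemma nil2_group_nilp2 : nilp2 (presented_group (@cactus_nil2_relation n)).
Proof.
apply: presented_nilp2 => i j k.
have := pgen_rel (nil2_central i j k).
by rewrite !multR mult1.
Qed.

Lemma nil2_generators : nil2_family n nil2_gen.
Proof.
rewrite /nil2_gen; split.
- move=> i /sigma_indexP[a <-]; rewrite extendE.
  by have := pgen_rel (nil2_involution a); rewrite expg2 gmulfM mult1.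
- move=> i j /sigma_indexP[a <-] /sigma_indexP[b <-] ab; rewrite !extendE.
  by have := pgen_rel (nil2_commute ab); rewrite multR mult1.
- by move=> *; apply: nil2_group_nilp2.
- move=> i j k i2 ij ik jk.
  have [|a Ea] := @sigma_indexP i; first lia.
  have [|b Eb] := @sigma_indexP j; first lia.
  have [|c Ec] := @sigma_indexP k; first lia.
  move: ij ik jk; rewrite -Ea -Eb -Ec !extendE => /andP[ab _] /andP[ac _] bc.
  by have := pgen_rel (nil2_parity ab ac bc); rewrite !multR.
Qed.

End Nil2Lift.

Section Presentation.
Variable n : nat.
Local Notation J := (cactus_group n).
Local Notation P := (presented_group (@cactus_nil2_relation n)).
Local Notation Q := (coset_group (lower_central J 3)).

(** The maps are [t i |-> sigma_{1,i}] and [sigma_{p,q} |-> sigma_of t p q]; the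
second kills the third term of the lower central series as its target has class
at most two.  The composites fix the generators: [sigma_of t 1 i] is [t i], and
the identity [cactus_conj] deals with [sigma_{p,q}]. *)
Lemma cactus_nil2_presentation :
  exists f : {multiplicative P -> Q}, bijective f /\
    forall i, f (pgen (@cactus_nil2_relation n) i) =
      qproj (lower_central J 3) (cactus_sigma i).
Proof.
have Q2 : nilp2 Q := @lower_central3_nilp2 J.
have P2 : nilp2 P := @nil2_group_nilp2 n.
pose proj : {multiplicative J -> Q} := qproj (lower_central J 3).
have sP := cactus_generators proj.
set s := (fun p q => _) in sP.
have [f fE] := nil2_lift (nil2_family_cactus Q2 sP).
have sE (x : cactus_index n) : s (val x).1 (val x).2 = proj (pgen (@cactus_relation n) x).
  by rewrite /s -surjective_pairing extendE.
have f_sigma i : f (pgen (@cactus_nil2_relation n) i) = proj (cactus_sigma i).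
  by rewrite fE -(sE (cactus_index_of i)).
exists f; split=> //.
have tP := nil2_generators n.
have [h hE] := cactus_lift (cactus_family_nil2 P2 tP).
have [k kE] := coset_lift (lower_central3_ker h P2).
exists k.
  apply: (presented_morph_ext (f := k \o f) (g := idfun)) => -[i i2n] /=.
  rewrite f_sigma kE hE /= /sigma_of.
  have -> : (i - 1 + 1 = i)%N by lia.
  rewrite (nil2_inv tP)// mul1g -[i]/(val (exist _ i i2n : sigma_index n)).
  by rewrite /nil2_gen extendE.
move=> a; rewrite -[a]qreprK kE.
have ft i : (2 <= i <= n)%N -> f (nil2_gen n i) = s 1%N i.
  by move=> /sigma_indexP[b <-]; rewrite /nil2_gen extendE fE.
apply: (presented_morph_ext (f := f \o h) (g := proj)) => -[[p q] /= pq].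
rewrite hE /= !gmulfM !ft; [|lia|lia].
by rewrite -sE /= (cactus_conj sP (r := p))//; lia.
Qed.

End Presentation.

(** * Normal forms *)

Section NormalForm.
Variables (G : groupType) (I K : finType) (g : I -> G) (a : K -> G).

Definition bitprod (J : Type) (r : seq J) (h : J -> G) (x : J -> bool) : G :=
  \prod_(j <- r) h j ^+ x j.

Definition normal_form (x : {ffun I -> bool}) (z : {ffun K -> bool}) : G :=
  bitprod (index_enum I) g x * bitprod (index_enum K) a z.

Hypothesis gI : forall i, g i * g i = 1.
Hypothesis aI : forall k, a k * a k = 1.
Hypothesis aC : forall k, central (a k).
Hypothesis gC : forall i j, exists z : {ffun K -> bool},
  [~ g i, g j] = bitprod (index_enum K) a z.

Let inC (c : G) := exists z : {ffun K -> bool}, c = bitprod (index_enum K) a z.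

Lemma expg_addb (x : G) (b c : bool) : x * x = 1 -> x ^+ b * x ^+ c = x ^+ (b (+) c).
Proof. by move=> xx; case: b; case: c; rewrite /= ?mulg1 ?mul1g. Qed.

Let inC1 : inC 1.
Proof. by exists [ffun=> false]; rewrite /bitprod big1// => k _; rewrite ffunE. Qed.

Let inCM c d : inC c -> inC d -> inC (c * d).
Proof.
move=> [z ->] [w ->]; exists [ffun k => z k (+) w k].
rewrite /bitprod -prodgM_commute => [|k l *].
  by apply: eq_bigr => k _; rewrite ffunE expg_addb.
exact/commuteX2/aC.
Qed.

Let inC_central c : inC c -> central c.
Proof.
move=> [z ->] x; apply/commute_sym/commute_prod => k _.
exact/commuteX/commute_sym/aC.
Qed.

(** Collection: [g j] moves to the right until it meets its own power in the
product, where it flips the exponent; each generator that it passes contributes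
a central commutator. *)
Lemma bitprod_mul_gen r j (x : {ffun I -> bool}) : uniq r -> j \in r ->
  exists (y : {ffun I -> bool}) c, inC c /\ g j * bitprod r g x = bitprod r g y * c.
Proof.
elim: r => // i r IHr /= /andP[ir ur].
have upd (y : {ffun I -> bool}) b :
    bitprod (i :: r) g [ffun k => if k == i then b else y k] = g i ^+ b * bitprod r g y.
  rewrite /bitprod big_cons ffunE eqxx; congr (_ * _).
  apply: eq_big_seq => k kr; rewrite ffunE; case: eqP => // ki.
  by rewrite -ki kr in ir.
rewrite inE /bitprod big_cons -/(bitprod r g x); case: eqVneq => [-> _|ji /= jr].
  exists [ffun k => if k == i then ~~ x i else x k], 1; split=> //.
  by rewrite -/(bitprod _ g _) upd mulgA mulg1 -[g i in LHS]expg1 (@expg_addb _ true).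
have [y [c [cC jE]]] := IHr ur jr.
exists [ffun k => if k == i then x i else y k], (c * [~ g j, g i ^+ x i]); split.
  apply: inCM => //; case: (x i); first exact: gC.
  by rewrite commg1.
have gjC : central [~ g j, g i ^+ x i].
  by apply: inC_central; case: (x i); [exact: gC | rewrite commg1].
rewrite -/(bitprod _ g _) upd mulgA (commgC (g j)).
move: [~ _, _] gjC => e gjC; rewrite -!mulgA.
by rewrite (gjC (bitprod _ _ _)) (mulgA (g j)) jE !mulgA.
Qed.

Lemma normal_form_mul_gen j x z : exists y w, g j * normal_form x z = normal_form y w.
Proof.
have [||y [c [cC E]]] := @bitprod_mul_gen (index_enum I) j x.
- exact: index_enum_uniq.
- exact: mem_index_enum.
have [w Ew] : inC (c * bitprod (index_enum K) a z) by apply: inCM => //; exists z.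
by exists y, w; rewrite /normal_form mulgA E -mulgA Ew.
Qed.

Lemma normal_form1 : normal_form [ffun=> false] [ffun=> false] = 1.
Proof.
by rewrite /normal_form /bitprod !big1 ?mulg1// => k _; rewrite ffunE.
Qed.

End NormalForm.

(** * A central extension defined by a bilinear form *)

Section Model.
Local Open Scope ring_scope.
Import GRing.Theory.
Variables (I K : finType).

(** The extension of [F_2 ^ I] by [F_2 ^ K] whose cocycle has as [k]-th coordinate
the bilinear form with matrix [B k].  The matrix appears in the type so that it determines
the group structure. *)
Definition cext (B : K -> I -> I -> bool) : Type :=
  ({ffun I -> bool} * {ffun K -> bool})%type.

Variable B : K -> I -> I -> bool.
Local Notation E := (cext B).
Implicit Types (x y : {ffun I -> bool}) (z w : {ffun K -> bool}).

Definition cocycle x y : {ffun K -> bool} :=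
  [ffun k => \sum_i \sum_j x i * y j * B k i j].

Lemma cocycleDl x x' y : cocycle (x + x') y = cocycle x y + cocycle x' y.
Proof.
apply/ffunP => k; rewrite !ffunE -big_split; apply: eq_bigr => i _ /=.
by rewrite -big_split; apply: eq_bigr => j _ /=; rewrite ffunE !mulrDl.
Qed.

Lemma cocycleDr x y y' : cocycle x (y + y') = cocycle x y + cocycle x y'.
Proof.
apply/ffunP => k; rewrite !ffunE -big_split; apply: eq_bigr => i _ /=.
by rewrite -big_split; apply: eq_bigr => j _ /=; rewrite ffunE mulrDr !mulrDl.
Qed.

Lemma cocycle0l y : cocycle 0 y = 0.
Proof. by apply: (addrI (cocycle 0 y)); rewrite -cocycleDl !addr0. Qed.

Lemma cocycle0r x : cocycle x 0 = 0.
Proof. by apply: (addrI (cocycle x 0)); rewrite -cocycleDr !addr0. Qed.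

Lemma ffun_addbb (J : finType) (x : {ffun J -> bool}) : x + x = 0.
Proof. by apply/ffunP => j; rewrite !ffunE; case: (x j). Qed.

HB.instance Definition _ := Finite.copy E ({ffun I -> bool} * {ffun K -> bool})%type.

Definition cext_mul (u v : E) : E := (u.1 + v.1, u.2 + v.2 + cocycle u.1 v.1).
Definition cext_one : E := (0, 0).
Definition cext_inv (u : E) : E := (u.1, u.2 + cocycle u.1 u.1).

Lemma cext_mulA : associative cext_mul.
Proof.
move=> [x z] [x' z'] [x'' z'']; rewrite /cext_mul /= addrA cocycleDl cocycleDr.
congr (_, _); rewrite -!addrA; do 2!congr (_ + _).
by rewrite [RHS]addrCA; congr (_ + _); rewrite addrC -addrA.
Qed.

Lemma cext_mul1g : left_id cext_one cext_mul.
Proof. by move=> [x z]; rewrite /cext_mul /= cocycle0l !add0r addr0. Qed.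

Lemma cext_mulg1 : right_id cext_one cext_mul.
Proof. by move=> [x z]; rewrite /cext_mul /= cocycle0r !addr0. Qed.

Lemma cext_mulVg : left_inverse cext_one cext_inv cext_mul.
Proof.
by move=> [x z]; rewrite /cext_mul /cext_inv /= ffun_addbb -addrA ffun_addbb.
Qed.

Lemma cext_mulgV : right_inverse cext_one cext_inv cext_mul.
Proof.
move=> [x z]; rewrite /cext_mul /cext_inv /= ffun_addbb (addrA z).
by rewrite ffun_addbb add0r ffun_addbb.
Qed.

HB.instance Definition _ := isGroup.Build E
  cext_mulA cext_mul1g cext_mulg1 cext_mulVg cext_mulgV.

Lemma cextM (x y : {ffun I -> bool}) z w :
  (((x, z) : E) * ((y, w) : E))%g = (x + y, z + w + cocycle x y).
Proof. by []. Qed.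

Lemma cext_central z : central ((0, z) : E).
Proof.
by move=> [y w]; rewrite /commute !cextM cocycle0l cocycle0r !addr0 add0r addrC.
Qed.

Lemma cext_commg x y z w : [~ (x, z) : E, (y, w) : E]%g =
  (0, cocycle x y + cocycle y x).
Proof.
apply: (mulgI (((y, w) : E) * ((x, z) : E))%g); rewrite -commgC !cextM.
rewrite cocycle0r !addr0 (addrC y); congr (_, _).
rewrite (addrC w) -!addrA; do 2!congr (_ + _).
by rewrite addrCA ffun_addbb addr0.
Qed.

Lemma cext_nilp2 : nilp2 E.
Proof.
by move=> [x z] [y w] u; rewrite cext_commg; apply/eqP/commgP/cext_central.
Qed.

Definition bit (J : finType) (i : J) : {ffun J -> bool} := [ffun j => j == i].

Definition cext_gen (i : I) : E := (bit i, 0).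

Lemma cocycle_bit i y : cocycle (bit i) y = [ffun k => \sum_j y j * B k i j].
Proof.
apply/ffunP => k; rewrite !ffunE (bigD1 i)//= [X in _ + X]big1 => [|i' i'i].
  by rewrite addr0; apply: eq_bigr => j _; rewrite ffunE eqxx mul1r.
by apply: big1 => j _; rewrite ffunE (negbTE i'i) !mul0r.
Qed.

Lemma cocycle_bits i j : cocycle (bit i) (bit j) = [ffun k => B k i j].
Proof.
rewrite cocycle_bit; apply/ffunP => k; rewrite !ffunE (bigD1 j)//= big1 => [|j' j'j].
  by rewrite ffunE eqxx mul1r addr0.
by rewrite ffunE (negbTE j'j) mul0r.
Qed.

Hypothesis Bii : forall k i, B k i i = false.

Lemma cext_gen_sqr i : (cext_gen i * cext_gen i)%g = 1%g.
Proof.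
rewrite cextM ffun_addbb addr0 add0r cocycle_bits; congr (_, _).
by apply/ffunP => k; rewrite !ffunE Bii.
Qed.

(** No cocycle term arises, because along [r] every earlier generator pairs to
zero, on the left, with every later one. *)
Lemma bitprod_gen (r : seq I) (x : {ffun I -> bool}) :
  pairwise (fun i j => (i != j) && [forall k, ~~ B k i j]) r ->
  bitprod r cext_gen x = ([ffun i => (i \in r) && x i], 0).
Proof.
elim: r => [_|i r IHr /= /andP[/allP ir /IHr{}IHr]].
  by rewrite /bitprod big_nil; congr (_, _); apply/ffunP => i; rewrite !ffunE.
have i_r : i \notin r by apply/negP => /ir; rewrite eqxx.
rewrite /bitprod big_cons -/(bitprod r _ x) IHr.
case xi: (x i); last first.
  rewrite mul1g; congr (_, _); apply/ffunP => j; rewrite !ffunE inE.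
  by case: eqVneq => // ->; rewrite xi andbF.
rewrite cextM; congr (_, _).
  apply/ffunP => j; rewrite !ffunE inE; case: eqVneq => [->|//].
  by rewrite (negbTE i_r) xi.
rewrite !add0r cocycle_bit; apply/ffunP => k; rewrite !ffunE big1// => j _.
rewrite ffunE; case: (boolP (j \in r)) => [/ir|]; last by rewrite mul0r.
by move=> /andP[_ /forallP/(_ k)/negbTE ->]; rewrite mulr0.
Qed.

Lemma bitprod_central (z : {ffun K -> bool}) (a : K -> E) :
  (forall k, a k = (0, bit k)) -> bitprod (index_enum K) a z = (0, z).
Proof.
move=> aE.
have -> (r : seq K) : bitprod r a z = (0, \sum_(k <- r | z k) bit k).
  elim: r => [|k r IHr]; first by rewrite /bitprod !big_nil.
  rewrite /bitprod !big_cons -/(bitprod r a z) IHr aE.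
  case: (z k); last by rewrite mul1g.
  by rewrite cextM cocycle0l !addr0.
congr (_, _); apply/ffunP => k; rewrite sum_ffunE.
case zk: (z k); last first.
  by apply: big1 => l zl; rewrite ffunE; case: eqP zl => // <-; rewrite zk.
rewrite (bigD1 k)//= ffunE eqxx big1 ?addr0// => l /andP[_ /negbTE lk].
by rewrite ffunE eq_sym lk.
Qed.

End Model.

Lemma val_index_enum_ord m : [seq val i | i <- index_enum 'I_m] = iota 0 m.
Proof. by rewrite -val_enum_ord enumT. Qed.

Lemma pairwise_index_enum_ord m (r : rel 'I_m) :
  (forall i j : 'I_m, (i < j)%N -> r i j) -> pairwise r (index_enum 'I_m).
Proof.
move=> lt_r; have : pairwise ltn [seq val i | i <- index_enum 'I_m].
  by rewrite val_index_enum_ord -sorted_pairwise ?iota_ltn_sorted//; apply: ltn_trans.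
by rewrite pairwise_map; apply: sub_pairwise.
Qed.

Lemma mult_bitprod (G H : groupType) (f : {multiplicative G -> H}) (J : Type)
    (r : seq J) (h : J -> G) (x : J -> bool) :
  f (bitprod r h x) = bitprod r (f \o h) x.
Proof.
rewrite /bitprod (big_morph f gmulfM (mult1 f)).
by apply: eq_bigr => j _; case: (x j); rewrite ?mult1.
Qed.

Lemma bitprod_bit (G : groupType) (J : finType) (h : J -> G) (j : J) :
  bitprod (index_enum J) h (bit j) = h j.
Proof.
rewrite /bitprod; have : j \in index_enum J by apply: mem_index_enum.
elim: (index_enum J) (index_enum_uniq J) => //= i r IHr /andP[ir ur].
rewrite inE big_cons ffunE => /predU1P[->|jr].
  rewrite eqxx big_seq big1 ?mulg1// => k kr.
  by rewrite ffunE; case: eqP kr ir => // -> ->.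
by rewrite IHr//; case: eqP jr ir => [->->|]//; rewrite mul1g.
Qed.

(** * The order of the class-two quotient *)

Section Order.
Variable n : nat.
Local Notation h := ((n + 1) %/ 2)%N.
Local Notation I := 'I_(n - 1).
Local Notation K := 'I_(n %/ 2).
Local Notation P := (presented_group (@cactus_nil2_relation n)).

Definition nil2_normal_form (G : groupType) (t : nat -> G)
    (u : {ffun I -> bool} * {ffun K -> bool}) : G :=
  normal_form (fun i : I => t (i + 2)%N)
    (fun k : K => [~ t (h + k)%N, t (h + k).+1]) u.1 u.2.

Lemma mult_nil2_normal_form (G H : groupType) (f : {multiplicative G -> H})
    (t : nat -> G) u :
  f (nil2_normal_form t u) = nil2_normal_form (f \o t) u.
Proof.
rewrite /nil2_normal_form /normal_form gmulfM !mult_bitprod; congr (_ * _).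
by apply: eq_bigr => k _ /=; rewrite multR.
Qed.

(** The coordinate [k] stands for [[~ t (h + k), t (h + k).+1]], and [i], [j] for
[t (i + 2)], [t (j + 2)].  Entries are nonzero only below the diagonal, so that
products of generators in increasing order involve no cocycle
(see [bitprod_gen]); symmetrizing the form yields the commutators. *)
Definition nil2_form (k : K) (i j : I) : bool :=
  [&& (j + 2 == h + k)%N, (j < i)%N & odd (i - j)].

Definition nil2_model := cext nil2_form.
HB.instance Definition _ := Group.on nil2_model.

Definition model_gen (i : nat) : nil2_model :=
  ([ffun a : I => (a + 2 == i)%N], [ffun=> false]).

Lemma model_genE (a : I) : model_gen (a + 2) = cext_gen nil2_form a.
Proof.
by congr (_, _); apply/ffunP => b; rewrite !ffunE// eqn_add2r.
Qed.

Lemma model_rangeP i : (2 <= i <= n)%N -> exists a : I, i = (a + 2)%N.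
Proof.
move=> i2n; have lt_i : (i - 2 < n - 1)%N by lia.
by exists (Ordinal lt_i) => /=; lia.
Qed.

Lemma model_commg (a b : I) : [~ model_gen (a + 2), model_gen (b + 2)] =
  ([ffun=> false], [ffun k => nil2_form k a b (+) nil2_form k b a]).
Proof.
rewrite !model_genE cext_commg !cocycle_bits; congr (_, _).
by apply/ffunP => k; rewrite !ffunE.
Qed.

Lemma model_family : nil2_family n model_gen.
Proof.
split.
- move=> i /model_rangeP[a ->]; rewrite model_genE; apply: cext_gen_sqr => k b.
  by rewrite /nil2_form ltnn andbF.
- move=> i j /model_rangeP[a ->] /model_rangeP[b ->] ab; rewrite model_commg.
  congr (_, _); apply/ffunP => k.
  have ba : nil2_form k a b = false by rewrite /nil2_form; case: ab => ab; lia.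
  have ab' : nil2_form k b a = false by rewrite /nil2_form; case: ab => ab; lia.
  by rewrite !ffunE ba ab'.
- by move=> *; apply: cext_nilp2.
- move=> i j k i2 ij ik jk.
  have [|a ?] := @model_rangeP i; first lia.
  have [|b ?] := @model_rangeP j; first lia.
  have [|c ?] := @model_rangeP k; first lia.
  subst i j k; rewrite !model_commg; congr (_, _); apply/ffunP => k.
  have ab : nil2_form k a b = false by rewrite /nil2_form; lia.
  have ac : nil2_form k a c = false by rewrite /nil2_form; lia.
  by rewrite !ffunE ab ac /nil2_form; lia.
Qed.

Lemma card_nil2_model : #|{: nil2_model}| = (2 ^ (n %/ 2 + n - 1))%N.
Proof.
rewrite card_prod !card_ffun !card_ord card_bool -expnD; congr (2 ^ _)%N; lia.
Qed.

Hypothesis n3 : (3 <= n)%N.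

(** The image of the normal form contains [1] and is stable under left
multiplication by the generators, which are involutions.  The hypothesis of
[normal_form_mul_gen] on commutators is [nil2_comm_parity]. *)
Lemma nil2_normal_form_onto (a : P) : exists u, a = nil2_normal_form (nil2_gen n) u.
Proof.
have P2 := @nil2_group_nilp2 n; have tP := nil2_generators n.
set t := nil2_gen n in tP *.
pose g (i : I) := t (i + 2)%N; pose c (k : K) := [~ t (h + k)%N, t (h + k).+1].
have gI i : g i * g i = 1 by apply: (nil2_inv tP); have := ltn_ord i; lia.
have cI k : c k * c k = 1.
  by apply: commg_sqr => //; apply: (nil2_inv tP); have := ltn_ord k; lia.
have cC k : central (c k) by apply: commg_central.
have gC i j : exists z : {ffun K -> bool}, [~ g i, g j] = bitprod (index_enum K) c z.
  wlog ij : i j / (i <= j)%N.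
    move=> W; case: (leqP i j) => [|/ltnW]; first exact: W.
    by rewrite commg_symm//; apply: W.
  rewrite /g (nil2_comm_parity tP); [|lia|have := ltn_ord j; lia].
  case: ifP => oij; last first.
    by exists [ffun=> false]; rewrite /bitprod big1// => k _; rewrite ffunE.
  have [ih|hi] := ltnP (i + 2) h.
    exists [ffun=> false]; rewrite /bitprod big1 => [|k _]; last by rewrite ffunE.
    by apply: (nil2_comm tP); [lia|have := ltn_ord j; lia|left].
  have lt_k : (i + 2 - h < n %/ 2)%N by have := ltn_ord j; lia.
  exists (bit (Ordinal lt_k)); rewrite bitprod_bit /c /=.
  by have -> : (h + (i + 2 - h) = i + 2)%N by lia.
have step i b : (exists u, b = nil2_normal_form t u) ->
    exists u, pgen (@cactus_nil2_relation n) i * b = nil2_normal_form t u.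
  move=> [[x z] ->]; case: i => i i2n.
  have lt_i : (i - 2 < n - 1)%N by lia.
  have [y [w E]] := normal_form_mul_gen gI cI cC gC (Ordinal lt_i) x z.
  exists (y, w); rewrite /nil2_normal_form -E; congr (_ * _).
  rewrite /g /= /t; have -> : (i - 2 + 2 = i)%N by lia.
  by rewrite -[i in RHS]/(val (exist _ i i2n : sigma_index n)) /nil2_gen extendE.
elim/presented_ind: a => [|i b|i b].
- by exists ([ffun=> false], [ffun=> false]); rewrite /nil2_normal_form normal_form1.
- exact: step.
- suff -> : (pgen (@cactus_nil2_relation n) i)^-1 = pgen (@cactus_nil2_relation n) i.
    exact: step.
  apply/mulg1_eq; have := nil2_inv tP (i := val i) (valP i).
  by rewrite /t /nil2_gen extendE.
Qed.

(** Since normal forms exhaust the presented group, the inverse of [f] sends [y] to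
the normal form whose exponents are those of [y]. *)
Lemma nil2_mult_bijective (G : groupType) (f : {multiplicative P -> G}) (t : nat -> G) :
    (forall i, f (pgen (@cactus_nil2_relation n) i) = t (val i)) ->
  bijective (nil2_normal_form t) -> bijective f.
Proof.
move=> ft [r rK Kr].
have ftE u : f (nil2_normal_form (nil2_gen n) u) = nil2_normal_form t u.
  have tE i : (2 <= i <= n)%N -> f (nil2_gen n i) = t i.
    by move=> /sigma_indexP[b <-]; rewrite /nil2_gen extendE ft.
  rewrite mult_nil2_normal_form /nil2_normal_form /normal_form /bitprod /=.
  congr (_ * _); apply: eq_bigr => k _ /=; have := ltn_ord k.
    by move=> ?; rewrite tE//; lia.
  by move=> ?; rewrite !tE//; lia.
exists (fun y => nil2_normal_form (nil2_gen n) (r y)) => [a|y].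
  by have [u ->] := nil2_normal_form_onto a; rewrite ftE rK.
by rewrite ftE Kr.
Qed.

Lemma model_normal_form u : nil2_normal_form model_gen u = u.
Proof.
case: u => x z; rewrite /nil2_normal_form /normal_form /=.
have -> : bitprod (index_enum I) (fun i : I => model_gen (i + 2)) x = (x, [ffun=> false]).
  transitivity (bitprod (index_enum I) (cext_gen nil2_form) x).
    by apply: eq_bigr => i _; rewrite model_genE.
  rewrite bitprod_gen.
    by congr (_, _); apply/ffunP => i; rewrite ffunE mem_index_enum.
  apply: pairwise_index_enum_ord => i j ij; apply/andP; split.
    by apply/eqP => ij'; rewrite ij' ltnn in ij.
  by apply/forallP => k; rewrite /nil2_form; lia.
rewrite bitprod_central => [|k].
  rewrite cextM cocycle0r; congr (_, _); apply/ffunP => k; rewrite !ffunE.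
    by case: (x k).
  by case: (z k).
have [|a Ea] := @model_rangeP (h + k); first by have := ltn_ord k; lia.
have [|b Eb] := @model_rangeP (h + k).+1; first by have := ltn_ord k; lia.
rewrite Eb Ea model_commg; congr (_, _); apply/ffunP => l; rewrite !ffunE /nil2_form.
rewrite -(inj_eq val_inj) /=; lia.
Qed.

Lemma nil2_model_iso : exists f : {multiplicative P -> nil2_model}, bijective f.
Proof.
have [f fE] := nil2_lift model_family.
exists f; apply: (nil2_mult_bijective fE).
by exists id => u; rewrite model_normal_form.
Qed.

End Order.

(** * The wreath products for four and five strands *)

Section Wreath.
Local Notation W := (wreath2 ('Z_2 * 'Z_2)%type).

Definition z2 (b : bool) : 'Z_2 := if b then Zp1 else Zp0.
Definition bit_of (x : 'Z_2) : bool := odd x.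

Lemma z2K : cancel z2 bit_of.
Proof. by case. Qed.

Lemma bit_ofK : cancel bit_of z2.
Proof. by move=> x; apply: val_inj; case: x => [[|[|?]] ?]. Qed.

Fact wr_proof (ax : 'Z_2 * (('Z_2 * 'Z_2) * ('Z_2 * 'Z_2))) :
  ax \in finset.setX [set: _]%SET [set: _]%SET.
Proof. by rewrite !inE. Qed.

(** Boolean coordinates, [t] for the swap and [(u1, u2)], [(v1, v2)] for the two
base factors, turn identities in the wreath product into boolean ones. *)
Definition wr (t u1 u2 v1 v2 : bool) : W :=
  SdPair (swap_groupAction _) (wr_proof (z2 t, ((z2 u1, z2 u2), (z2 v1, z2 v2)))).

Lemma wr_ind (K : W -> Prop) :
  (forall t u1 u2 v1 v2, K (wr t u1 u2 v1 v2)) -> forall w, K w.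
Proof.
move=> Kwr [[t [[u1 u2] [v1 v2]]] w].
rewrite (_ : SdPair _ w =
  wr (bit_of t) (bit_of u1) (bit_of u2) (bit_of v1) (bit_of v2)) //.
by apply: val_inj; rewrite /= !bit_ofK.
Qed.

Lemma z2M : {morph z2 : a b / a (+) b >-> a * b}.
Proof. by do 2!case; apply: val_inj. Qed.

Lemma swap_act_z2 (x : ('Z_2 * 'Z_2) * ('Z_2 * 'Z_2)) b :
  swap_act x (z2 b) = if b then (x.2, x.1) else x.
Proof. by case: b. Qed.

Lemma wr1 : wr false false false false false = 1.
Proof. exact: val_inj. Qed.

Lemma wrM t u1 u2 v1 v2 t' u1' u2' v1' v2' :
  wr t u1 u2 v1 v2 * wr t' u1' u2' v1' v2' =
  wr (t (+) t') ((if t' then v1 else u1) (+) u1') ((if t' then v2 else u2) (+) u2')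
    ((if t' then u1 else v1) (+) v1') ((if t' then u2 else v2) (+) v2').
Proof. by apply: val_inj; rewrite /= swap_act_z2 !z2M; case: t'. Qed.

Lemma wrV t u1 u2 v1 v2 :
  (wr t u1 u2 v1 v2)^-1 = if t then wr t v1 v2 u1 u2 else wr t u1 u2 v1 v2.
Proof.
by apply: mulg1_eq; case: t; rewrite wrM !addbb wr1.
Qed.

Definition wr_simpl := (wrM, wrV).

(** The image of [t (i + 2)].  The swap is the image of [t 3], which commutes with
neither [t 2] nor [t 4]; its commutators with the generators of one base factor
generate the diagonal of the base. *)
Definition wr_gen (i : nat) : W :=
  match i with
  | 0 => wr false true false false false
  | 1 => wr true false false false false
  | _ => wr false false true false false
  end.

(** The value of the normal form with exponents [x0], [x1], [x2] of the generators
and [y0], [y1] of the commutators. *)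
Definition wr_nf (x0 x1 x2 y0 y1 : bool) : W :=
  wr x1 ((~~ x1 && x0) (+) y0) (x2 (+) y1) ((x1 && x0) (+) y0) y1.

Lemma wr_wordE (x0 x1 x2 y0 y1 : bool) :
  wr_gen 0 ^+ x0 * (wr_gen 1 ^+ x1 * wr_gen 2 ^+ x2) *
    ([~ wr_gen 0, wr_gen 1] ^+ y0 * [~ wr_gen 1, wr_gen 2] ^+ y1) =
  wr_nf x0 x1 x2 y0 y1.
Proof.
rewrite /wr_nf /commg /conjg !wr_simpl /=.
by case: x0; case: x1; case: x2; case: y0; case: y1;
  rewrite ?expg0 ?expg1 ?mulg1 ?mul1g ?wrM -?wr1.
Qed.

Lemma wr_family4 : nil2_family 4 (fun i => wr_gen (i - 2)).
Proof.
split.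
- by move=> [|[|[|[|[|i]]]]]//= _; rewrite wrM wr1.
- by move=> [|[|[|[|[|i]]]]]//= [|[|[|[|[|j]]]]]//= _ _ [|/eqP]//= _;
    rewrite /commg /conjg !wr_simpl wr1.
- by move=> [|[|[|[|[|i]]]]]//= [|[|[|[|[|j]]]]]//= [|[|[|[|[|k]]]]]//= _ _ _;
    rewrite /commg /conjg !wr_simpl wr1.
- by move=> [|[|[|[|[|i]]]]]//= [|[|[|[|[|j]]]]]//= [|[|[|[|[|k]]]]]//= _ _ _ /eqP// _;
    rewrite /commg /conjg !wr_simpl.
Qed.

End Wreath.

Local Notation W := (wreath2 ('Z_2 * 'Z_2)%type).

Definition bits m (s : seq bool) : {ffun 'I_m -> bool} :=
  [ffun i : 'I_m => nth false s i].

Lemma bits_seq m (x : {ffun 'I_m -> bool}) : exists2 s, size s = m & x = bits m s.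
Proof.
exists (codom x); first by rewrite size_codom card_ord.
apply/ffunP => i; rewrite ffunE (nth_map i) ?size_enum_ord//.
by rewrite nth_ord_enum.
Qed.

Lemma wr_normal_form4 x0 x1 x2 y0 y1 :
  nil2_normal_form (n := 4) (fun i => wr_gen (i - 2))
    (bits _ [:: x0; x1; x2], bits _ [:: y0; y1]) =
  wr_nf x0 x1 x2 y0 y1.
Proof.
rewrite -wr_wordE /nil2_normal_form /normal_form /bitprod.
by rewrite !big_ord_recl !big_ord0 !ffunE /= !mulg1.
Qed.

Lemma pair_mulE (G H : groupType) (a c : G) (b d : H) : (a, b) * (c, d) = (a * c, b * d).
Proof. by []. Qed.

Lemma pair_commE (G H : groupType) (a c : G) (b d : H) :
  [~ (a, b), (c, d)] = ([~ a, c], [~ b, d]).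
Proof. by []. Qed.

Lemma pair_expE (G H : groupType) (a : G) (b : H) (x : bool) :
  (a, b) ^+ x = (a ^+ x, b ^+ x).
Proof. by case: x. Qed.

(** The index is that of [t] shifted by two, so [0] stands for the central
generator [t 2]. *)
Definition wr5_gen (i : nat) : 'Z_2 * W :=
  if i == 0%N then (z2 true, 1) else (1, wr_gen i.-1).

Lemma wr_family5 : nil2_family 5 (fun i => wr5_gen (i - 2)).
Proof.
have tP := wr_family4.
have c2 j : [~ wr5_gen 0, wr5_gen j] = 1.
  by case: j => [|j]; rewrite ?commgg// pair_commE commg1 comm1g.
have c3 i j : [~ wr5_gen i.+1, wr5_gen j.+1] = (1, [~ wr_gen i, wr_gen j]).
  by rewrite pair_commE commgg.
have E k : (k.+3 - 2 = k.+1)%N by lia.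
have E' k : (k.+2 - 2 = k)%N by lia.
split.
- move=> [|[|[|i]]]// i5; first by rewrite pair_mulE mulg1; congr (_, _); apply: val_inj.
  rewrite E pair_mulE mulg1 /=; congr (_, _).
  by have := nil2_inv tP (i := i.+2); rewrite E'; apply; lia.
- move=> [|[|[|i]]]// [|[|[|j]]]// i5 j5 ij; rewrite ?c2//.
    by rewrite -invgR c2 invg1.
  rewrite !E c3; congr (_, _).
  have := nil2_comm tP (i := i.+2) (j := j.+2); rewrite !E'; apply; [lia|lia|].
  by case: ij => ij; [left|right]; move: ij => /=; lia.
- move=> [|[|[|i]]]// [|[|[|j]]]// k i5 j5 k5; rewrite ?c2 ?comm1g//.
    by rewrite -(invgR (wr5_gen 0)) c2 invg1 comm1g.
  rewrite !E c3; case: k k5 => [|[|[|k]]]// k5.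
    by rewrite pair_commE commg1 comm1g.
  rewrite E pair_commE comm1g; congr (_, _).
  by have := nil2_centr tP (i := i.+2) (j := j.+2) (k := k.+2); rewrite !E'; apply; lia.
- move=> [|[|[|i]]]// [|[|[|j]]]// [|[|[|k]]]// i5 j5 k5 jk; rewrite ?c2//.
  rewrite !E !c3; congr (_, _).
  by have := nil2_par tP (i := i.+2) (j := j.+2) (k := k.+2); rewrite !E'; apply; lia.
Qed.

Lemma wr_normal_form5 x0 x1 x2 x3 y0 y1 :
  nil2_normal_form (n := 5) (fun i => wr5_gen (i - 2))
    (bits _ [:: x0; x1; x2; x3], bits _ [:: y0; y1]) =
  (z2 x0, wr_nf x1 x2 x3 y0 y1).
Proof.
rewrite -wr_wordE /nil2_normal_form /normal_form /bitprod.
rewrite !big_ord_recl !big_ord0 !ffunE /= !mulg1 /wr5_gen/=.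
rewrite !pair_commE !pair_expE !pair_mulE !commgg !expg1n !mulg1 !mul1g.
by congr (_, _); case: x0.
Qed.

Lemma wr_inj t u1 u2 v1 v2 t' u1' u2' v1' v2' :
  wr t u1 u2 v1 v2 = wr t' u1' u2' v1' v2' ->
  [/\ t = t', u1 = u1', u2 = u2', v1 = v1' & v2 = v2'].
Proof.
move/(congr1 val) => /= [] /(can_inj z2K) -> /(can_inj z2K) -> /(can_inj z2K) ->.
by move=> /(can_inj z2K) -> /(can_inj z2K) ->.
Qed.

Lemma wr_nf_inj x0 x1 x2 y0 y1 x0' x1' x2' y0' y1' :
    wr_nf x0 x1 x2 y0 y1 = wr_nf x0' x1' x2' y0' y1' ->
  [/\ x0 = x0', x1 = x1', x2 = x2', y0 = y0' & y1 = y1'].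
Proof.
move=> /wr_inj[-> eu1 eu2 ev1 ey1]; move: eu2; rewrite ey1 => /addIb ->.
case: x1' eu1 ev1 => /= [-> /addIb ->|/[swap] -> /addIb ->] //.
Qed.

Lemma wr_nf_surj t u1 u2 v1 v2 : exists x0 x1 x2 y0 y1,
  wr_nf x0 x1 x2 y0 y1 = wr t u1 u2 v1 v2.
Proof.
(* The exponent [y0] is the first coordinate of the base factor that [t 2] does
   not reach; as [t 2] stands to the left of the swap, this depends on [t]. *)
exists (u1 (+) v1), t, (u2 (+) v2), (if t then u1 else v1), v2.
by rewrite /wr_nf; case: t; rewrite /= ?addbK // (addbC u1) addbK.
Qed.

Lemma wr_normal_form4_bij :
  bijective (nil2_normal_form (n := 4) (fun i => wr_gen (i - 2))).
Proof.
apply: bijective_inj_surj => [[x z] [x' z']|].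
  have [[|? [|? [|? [|//]]]] // _ ->] := bits_seq x.
  have [[|? [|? [|//]]] // _ ->] := bits_seq z.
  have [[|? [|? [|? [|//]]]] // _ ->] := bits_seq x'.
  have [[|? [|? [|//]]] // _ ->] := bits_seq z'.
  by rewrite !wr_normal_form4 => /wr_nf_inj[-> -> -> -> ->].
elim/wr_ind => t u1 u2 v1 v2.
have [x0 [x1 [x2 [y0 [y1 <-]]]]] := wr_nf_surj t u1 u2 v1 v2.
by exists (bits _ [:: x0; x1; x2], bits _ [:: y0; y1]); rewrite wr_normal_form4.
Qed.

Lemma wr_normal_form5_bij :
  bijective (nil2_normal_form (n := 5) (fun i => wr5_gen (i - 2))).
Proof.
apply: bijective_inj_surj => [[x z] [x' z']|[s w]].
  have [[|? [|? [|? [|? [|//]]]]] // _ ->] := bits_seq x.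
  have [[|? [|? [|//]]] // _ ->] := bits_seq z.
  have [[|? [|? [|? [|? [|//]]]]] // _ ->] := bits_seq x'.
  have [[|? [|? [|//]]] // _ ->] := bits_seq z'.
  rewrite !wr_normal_form5 => /pair_equal_spec[/(can_inj z2K) -> /wr_nf_inj].
  by move=> [-> -> -> -> ->].
move: w; elim/wr_ind => t u1 u2 v1 v2.
have [x0 [x1 [x2 [y0 [y1 <-]]]]] := wr_nf_surj t u1 u2 v1 v2.
exists (bits _ [:: bit_of s; x0; x1; x2], bits _ [:: y0; y1]).
by rewrite wr_normal_form5 bit_ofK.
Qed.

Local Close Scope group_scope.

Theorem theorem4 :
  (forall n : nat, 3 <= n ->
     ([set: coset_group (lower_central (cactus_group n) 3)]
        #= `I_(2 ^ (n %/ 2 + n - 1)))%card /\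
     (exists f : {multiplicative presented_group (@cactus_nil2_relation n) ->
                    coset_group (lower_central (cactus_group n) 3)},
        bijective f /\
        forall i : sigma_index n,
          f (pgen (@cactus_nil2_relation n) i) =
          qproj (lower_central (cactus_group n) 3) (cactus_sigma i))) /\
  isomorphic (coset_group (lower_central (cactus_group 4) 3))
    (wreath2 ('Z_2 * 'Z_2)%type) /\
  isomorphic (coset_group (lower_central (cactus_group 5) 3))
    ('Z_2 * wreath2 ('Z_2 * 'Z_2)%type)%type.
Proof.
split; [|split].
- move=> n n3; have [f [f_bij fE]] := cactus_nil2_presentation n.
  split; last by exists f.
  have [g g_bij] := nil2_model_iso n3.
  have [f' fK f'K] := f_bij.
  rewrite -card_nil2_model //; apply: (@card_bijective _ _ (g \o f')).
  by apply: (bij_comp g_bij); exists f.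
- have [f [f_bij _]] := cactus_nil2_presentation 4.
  have [g gE] := nil2_lift wr_family4.
  exact: (isomorphic_bijective f_bij
    (nil2_mult_bijective (n := 4) isT gE wr_normal_form4_bij)).
have [f [f_bij _]] := cactus_nil2_presentation 5.
have [g gE] := nil2_lift wr_family5.
exact: (isomorphic_bijective f_bij
  (nil2_mult_bijective (n := 5) isT gE wr_normal_form5_bij)).
Qed.
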